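(* Let $(X,d)$ be a complete CAT(0) space and $F:X\to(-\infty,\infty]$ be a proper, convex and lower semicontinuous mapping. Assume that $F$ has a minimizer. Then for all $\mu>0$ and all $x\in X$, the Picard iterate $(J_\mu^n(x))_n$ of the resolvent $J_\mu$ of $F$ of order $\mu$ $\Delta$-converges to a minimizer of $F$.
   Context: A geodesic in a metric space $(X,d)$ is a map $\gamma:[a,b]\to X$ with $d(\gamma(s),\gamma(t))=|s-t|$ for all $s,t\in[a,b]$; $X$ is a geodesic space if any two distinct points are the endpoints $\gamma(a),\gamma(b)$ of some geodesic. A CAT(0) space is a geodesic space such that for all $x,y,z\in X$ and all $m\in X$ with $d(x,m)=d(y,m)=\frac12d(x,y)$ one has $d(z,m)^2\le\frac12d(z,x)^2+\frac12d(z,y)^2-\frac14d(x,y)^2$. $F:X\to(-\infty,\infty]$ is convex if $F\circ\gamma$ is convex for every geodesic $\gamma$ in $X$, and proper if $F(x)<\infty$ for some $x\in X$. A minimizer of $F$ is a point $x\in X$ with $F(x)\le F(y)$ for all $y\in X$. For $F$ proper, convex and lower semicontinuous on a complete CAT(0) space and $\mu>0$, for each $x\in X$ there is a unique point $J_\mu(x)\in X$ with $\mu F(J_\mu(x))+d(x,J_\mu(x))^2=\inf_{y\in X}\{\mu F(y)+d(x,y)^2\}$; the map $J_\mu:X\to X$ is the resolvent of $F$ of order $\mu$. For a bounded sequence $(x_n)$ in $X$, a point $c\in X$ is an asymptotic center of $(x_n)$ if $\limsup_{n\to\infty}d(c,x_n)=\inf_{y\in X}\limsup_{n\to\infty}d(y,x_n)$.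 A bounded sequence $(x_n)$ $\Delta$-converges to $x\in X$ if $x$ is the unique asymptotic center of every subsequence of $(x_n)$. *)

(* Defs.v *)
From HB Require Import structures.
From mathcomp Require Import all_boot all_order all_algebra.
From mathcomp Require Import boolp classical_sets reals ereal.
From mathcomp Require Import topology normedtype sequences.

Set Implicit Arguments.
Unset Strict Implicit.
Unset Printing Implicit Defensive.

Import Order.TTheory GRing.Theory Num.Theory.

Local Open Scope classical_set_scope.
Local Open Scope ring_scope.

Definition complete_space (R : realType) (X : metricType R) : Prop :=
  forall u : nat -> X, cauchy (u @ \oo) -> exists l : X, u @ \oo --> l.

(* A map [a, b] -> X is represented by a map R -> X whose values outside
   [a, b] are irrelevant. *)
Definition geodesic (R : realType) (X : metricType R)
    (g : R -> X) (a b : R) : Prop :=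
  a <= b /\
  forall s t, s \in `[a, b] -> t \in `[a, b] -> mdist (g s) (g t) = `|s - t|.

Definition geodesic_space (R : realType) (X : metricType R) : Prop :=
  forall x y : X, x <> y ->
    exists (g : R -> X) (a b : R), [/\ geodesic g a b, g a = x & g b = y].

Definition CAT0_space (R : realType) (X : metricType R) : Prop :=
  geodesic_space X /\
  forall x y z m : X,
    mdist x m = 2^-1 * mdist x y -> mdist y m = 2^-1 * mdist x y ->
    mdist z m ^+ 2 <=
      2^-1 * mdist z x ^+ 2 + 2^-1 * mdist z y ^+ 2 - 4^-1 * mdist x y ^+ 2.

(* For F with values in ]-oo, +oo]; the convention 0 * +oo = 0 makes the cases
   l = 0 and l = 1 trivially true. *)
Definition geodesically_convex (R : realType) (X : metricType R)
    (F : X -> \bar R) : Prop :=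
  forall (g : R -> X) (a b : R), geodesic g a b ->
  forall s t l : R, s \in `[a, b] -> t \in `[a, b] -> l \in `[0, 1] ->
    (F (g ((1 - l) * s + l * t)%R) <=
       (1 - l)%R%:E * F (g s) + l%:E * F (g t))%E.

Definition proper_function (R : realType) (X : metricType R)
    (F : X -> \bar R) : Prop :=
  exists x : X, (F x < +oo)%E.

Definition minimizer (R : realType) (X : metricType R)
    (F : X -> \bar R) (x : X) : Prop :=
  forall y : X, (F x <= F y)%E.

Definition resolvent_objective (R : realType) (X : metricType R)
    (F : X -> \bar R) (mu : R) (x y : X) : \bar R :=
  (mu%:E * F y + (mdist x y ^+ 2)%:E)%E.

(* The point p attaining the infimum; the default value x would only be
   returned if there were no such point. *)
Definition resolvent (R : realType) (X : metricType R)
    (F : X -> \bar R) (mu : R) (x : X) : X :=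
  xget x [set p | resolvent_objective F mu x p =
                  ereal_inf (range (resolvent_objective F mu x))].

Definition bounded_sequence (R : realType) (X : metricType R)
    (u : nat -> X) : Prop :=
  exists (c : X) (M : R), forall n, mdist c (u n) <= M.

Definition asymptotic_radius (R : realType) (X : metricType R)
    (u : nat -> X) (y : X) : \bar R :=
  limn_esup (fun n => (mdist y (u n))%:E).

Definition asymptotic_center (R : realType) (X : metricType R)
    (u : nat -> X) (c : X) : Prop :=
  asymptotic_radius u c = ereal_inf (range (asymptotic_radius u)).

Definition Delta_cvg (R : realType) (X : metricType R)
    (u : nat -> X) (x : X) : Prop :=
  bounded_sequence u /\
  forall phi : nat -> nat, increasing_seq phi ->
    asymptotic_center (u \o phi) x /\
    forall c : X, asymptotic_center (u \o phi) c -> c = x.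

(* Main.v *)
(* A function g on a complete CAT(0) space that is bounded below, has closed
   sublevel sets and satisfies g(m) <= g(y)/2 + g(z)/2 - d(y,z)^2/4 at midpoints
   attains its minimum at a point c, and then g(c) + d(c,y)^2 <= g(y) for all y.
   This applies both to g(y) = mu F(y) + d(x,y)^2, with c = J(x), and to the
   squared asymptotic radius r of a bounded sequence, with c its asymptotic
   center.  For the Picard iterates u_n, the former growth inequality at a
   minimizer q shows that d(u_n,q) is nonincreasing and that F(u_n) tends to
   min F.  If c is the asymptotic center of a subsequence, the same inequality
   for J(c) at the points u_n gives r(Jc) + d(c,Jc)^2 <= r(c) in the limit, hence
   J(c) = c and c is a minimizer.  Since d(u_n,q) converges for every minimizer
   q, the squared radii at q of the sequence and of its subsequences agree, which
   forces all asymptotic centers to coincide. *)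

Require Import Defs.
From mathcomp Require Import all_boot all_order all_algebra.
From mathcomp Require Import boolp classical_sets reals ereal.
From mathcomp Require Import topology normedtype sequences.
From mathcomp Require Import lra.
Import Order.TTheory GRing.Theory Num.Theory.
Local Open Scope classical_set_scope.
Local Open Scope ring_scope.

(** * Midpoints and minimization of strongly midconvex functions *)

Definition midpoint {R : realType} {X : metricType R} (y z m : X) : Prop :=
  mdist y m = 2^-1 * mdist y z /\ mdist z m = 2^-1 * mdist y z.

(** The parameter has the shape used in [geodesically_convex] for [l] equal to 1/2, so the same
    point serves for the convexity of [F]. *)
Lemma geodesic_midpoint {R : realType} {X : metricType R} (g : R -> X)
    (a b : R) : geodesic g a b ->
  midpoint (g a) (g b) (g ((1 - 2^-1) * a + 2^-1 * b)).
Proof.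
move=> [ab gE]; have [aI bI] : a \in `[a, b] /\ b \in `[a, b].
  by rewrite !in_itv/= !lexx ab.
have mI : (1 - 2^-1) * a + 2^-1 * b \in `[a, b].
  by rewrite in_itv/=; apply/andP; split; lra.
rewrite /midpoint !gE//.
rewrite !(distrC a) (ger0_norm (_ : 0 <= b - a)) ?subr_ge0//.
rewrite !ger0_norm; lra.
Qed.

Lemma CAT0_midpoint {R : realType} {X : metricType R} (y z : X) :
  CAT0_space X -> exists m, midpoint y z m.
Proof.
move=> [geo _]; have [<-|/geo[g [a [b [gab <- <-]]]]] := pselect (y = z).
  by exists y; rewrite /midpoint !mdistxx mulr0.
by eexists; exact: geodesic_midpoint gab.
Qed.

(** The set [D] stands for the points where an extended-valued function is finite, so that [g] can
    be real-valued. A minimizing sequence is Cauchy, because midpoints cannot go below the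
    infimum. *)
Lemma strongly_midconvex_argmin {R : realType} {X : metricType R}
    (D : set X) (g : X -> R) (b : R) :
  complete_space X -> D !=set0 -> (forall y, D y -> b <= g y) ->
  (forall (u : nat -> X) l a, u @ \oo --> l ->
    (\forall n \near \oo, D (u n) /\ g (u n) <= a) -> D l /\ g l <= a) ->
  (forall y z, D y -> D z -> exists m, [/\ midpoint y z m, D m &
    g m <= 2^-1 * g y + 2^-1 * g z - 4^-1 * mdist y z ^+ 2]) ->
  exists c, D c /\ forall y, D y -> g c + mdist c y ^+ 2 <= g y.
Proof.
move=> Xc [y0 Dy0] gb lsc cvx.
pose I := inf (g @` D).
have hI : has_inf (g @` D).
  by split; [exists (g y0), y0 | exists b => _ [y Dy <-]; exact: gb].
have Ile y : D y -> I <= g y.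
  by move=> Dy; apply: ge_inf; [exact: hI.2|exists y].
have /choice[u uP] n : exists y, D y /\ g y < I + n.+1%:R^-1.
  have n0 : 0 < n.+1%:R^-1 :> R by rewrite invr_gt0.
  have [_ [y Dy <-] yI] := inf_adherent n0 hI.
  by exists y.
have uI (e : R) : 0 < e -> \forall n \near \oo, D (u n) /\ g (u n) <= I + e.
  move=> e0; near=> n; have [Dn gn] := uP n; split => //.
  rewrite (le_trans (ltW gn))// lerD2l ltW//; near: n.
  exact: (near_infty_natSinv_lt (PosNum e0)).
have [c uc] : exists c : X, u @ \oo --> c.
  apply: Xc; apply/cauchy_ballP => e e0.
  (* If both values are at most [I + e ^+ 2 / 8], comparing the midpoint value with [I] bounds the
     squared distance by [e ^+ 2 / 2]. *)
  have e4 : 0 < e ^+ 2 / 8 by rewrite divr_gt0// exprn_gt0.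
  have [N _ hN] := uI _ e4.
  exists (u @` [set n | (N <= n)%N], u @` [set n | (N <= n)%N]).
    by split; exists N => // n Nn; exists n.
  move=> [_ _] [/= [n Nn <-] [k Nk <-]]; rewrite ballEmdist/=.
  have [Dn gn] := hN _ Nn; have [Dk gk] := hN _ Nk.
  have [m [_ Dm gm]] := cvx _ _ Dn Dk.
  rewrite -(ltr_pXn2r (_ : 0 < 2)%N) ?nnegrE ?mdist_ge0 ?(ltW e0)//.
  have := Ile _ Dm; have : 0 < e ^+ 2 by rewrite exprn_gt0.
  lra.
have cI (e : R) : 0 < e -> D c /\ g c <= I + e.
  by move=> e0; apply: (lsc u) => //; exact: uI.
have Dc : D c := (cI _ ltr01).1.
have gc : g c <= I by apply/ler_addgt0Pl => e /cI[]; rewrite addrC.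
exists c; split => // y Dy.
(* Each use of midpoint convexity between c and z improves the growth
   constant from t to (t + 1) / 2. *)
have growth n z : D z -> g c + (1 - (2 ^+ n)^-1) * mdist c z ^+ 2 <= g z.
  elim: n z => [|n IH] z Dz.
    by rewrite expr0 invr1 subrr mul0r addr0 (le_trans gc)// Ile.
  have [m [[cm _] Dm gm]] := cvx _ _ Dc Dz.
  have := IH _ Dm; rewrite cm exprMn.
  rewrite [2 ^+ n.+1]exprS invfM.
  set t := (2 ^+ n)^-1; set d := mdist c z ^+ 2 in gm *.
  rewrite expr2; nra.
(* Let [n] tend to infinity in [growth]: the error is the squared distance divided by [2 ^+ n]. *)
apply/ler_addgt0Pl => e e0.
have [d0|d0] := leP (mdist c y ^+ 2) 0.
  by have := growth 0 y Dy; rewrite expr0 invr1; lra.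
have [n _ /(_ n (leqnn n))] :=
  near_infty_natSinv_expn_lt (PosNum (divr_gt0 e0 d0)).
rewrite /= ltr_pdivlMr// => ne.
by have := growth n y Dy; rewrite mulrBl mul1r; lra.
Unshelve. all: by end_near. Qed.

(** * Asymptotic radii and centers of bounded sequences *)

Lemma asymptotic_radius_le {R : realType} {X : metricType R} (u : nat -> X)
    (y : X) (a : R) :
  (\forall n \near \oo, mdist y (u n) <= a) -> (asymptotic_radius u y <= a%:E)%E.
Proof.
move=> ua; apply: ge_ereal_inf; eexists; first by eexists; [exact: ua|].
by apply/ereal_supP => _ [n /= una <-]; rewrite lee_fin.
Qed.

Lemma asymptotic_radius_near {R : realType} {X : metricType R} (u : nat -> X)
    (y : X) (a : R) :
  (asymptotic_radius u y < a%:E)%E -> \forall n \near \oo, mdist y (u n) < a.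
Proof.
move=> /ereal_inf_lt[_ [V Voo <-] Va]; apply: filterS Voo => n Vn.
rewrite -lte_fin (le_lt_trans _ Va)//.
by apply: ereal_sup_ubound; exists n.
Qed.

Lemma asymptotic_radius_ge0 {R : realType} {X : metricType R} (u : nat -> X)
    (y : X) : (0 <= asymptotic_radius u y)%E.
Proof.
rewrite leNgt; apply/negP => /asymptotic_radius_near[N _ /(_ N (leqnn N))].
by rewrite ltNge mdist_ge0.
Qed.

Lemma bounded_asymptotic_radius {R : realType} {X : metricType R}
    (u : nat -> X) (y : X) : bounded_sequence u ->
  asymptotic_radius u y \is a fin_num.
Proof.
move=> [c [M uM]]; rewrite ge0_fin_numE ?asymptotic_radius_ge0//.
apply: (@le_lt_trans _ _ (mdist y c + M)%:E); last exact: ltry.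
apply: asymptotic_radius_le; apply: nearW => n.
by rewrite (le_trans (metric_triangle _ c _))// lerD2l.
Qed.

(** The square matches the quadratic CAT(0) inequality; [fine] loses nothing for bounded sequences,
    whose radii are finite. *)
Definition sq_radius {R : realType} {X : metricType R} (u : nat -> X) (y : X)
  : R := fine (asymptotic_radius u y) ^+ 2.

Lemma sq_radius_le {R : realType} {X : metricType R} (u : nat -> X) (y : X)
    (a : R) : bounded_sequence u ->
  (\forall n \near \oo, mdist y (u n) ^+ 2 <= a) -> sq_radius u y <= a.
Proof.
move=> ub ua; have a0 : 0 <= a.
  by case: ua => N _ /(_ N (leqnn N)); apply: le_trans; rewrite sqr_ge0.
rewrite /sq_radius -[leRHS]sqr_sqrtr// lerXn2r// ?nnegrE ?sqrtr_ge0//.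
  by rewrite fine_ge0// asymptotic_radius_ge0.
rewrite -lee_fin fineK ?bounded_asymptotic_radius//.
apply: asymptotic_radius_le; apply: filterS ua => n una.
by rewrite -[leLHS]ger0_norm ?mdist_ge0// -sqrtr_sqr ler_sqrt.
Qed.

(** Together with [sq_radius_le], this lets quadratic inequalities between distances to [u n] pass
    to the limsup. *)
Lemma sq_radius_near {R : realType} {X : metricType R} (u : nat -> X) (y : X)
    (e : R) : bounded_sequence u -> 0 < e ->
  \forall n \near \oo, mdist y (u n) ^+ 2 <= sq_radius u y + e.
Proof.
move=> ub e0; have r0 : 0 <= sq_radius u y by rewrite sqr_ge0.
have : (asymptotic_radius u y < (Num.sqrt (sq_radius u y + e))%:E)%E.
  rewrite -[ltLHS]fineK ?bounded_asymptotic_radius// lte_fin.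
  rewrite -[ltLHS]ger0_norm ?fine_ge0 ?asymptotic_radius_ge0// -sqrtr_sqr.
  by rewrite ltr_sqrt ?ltrDl// ltr_wpDl.
move=> /asymptotic_radius_near; apply: filterS => n /ltW un.
rewrite -[leRHS]sqr_sqrtr; last by rewrite addr_ge0// ltW.
by rewrite lerXn2r// nnegrE ?mdist_ge0 ?sqrtr_ge0.
Qed.

Lemma asymptotic_centerP {R : realType} {X : metricType R} (u : nat -> X)
    (c : X) : bounded_sequence u ->
  asymptotic_center u c <-> forall y, sq_radius u c <= sq_radius u y.
Proof.
move=> ub.
have sqE y : (sq_radius u c <= sq_radius u y) =
    (asymptotic_radius u c <= asymptotic_radius u y)%E.
  rewrite -(fineK (bounded_asymptotic_radius u c ub)).
  rewrite -(fineK (bounded_asymptotic_radius u y ub)) lee_fin.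
  by rewrite /sq_radius ler_pXn2r// nnegrE fine_ge0// asymptotic_radius_ge0.
split=> [cE y|cmin].
  by rewrite sqE cE; apply: ereal_inf_lbound; exists y.
apply/eqP; rewrite eq_le; apply/andP; split.
  by apply/ereal_infP => _ [y _ <-]; rewrite -sqE.
by apply: ereal_inf_lbound; exists c.
Qed.

Lemma sq_radius_argmin {R : realType} {X : metricType R} (u : nat -> X) :
  complete_space X -> CAT0_space X -> bounded_sequence u ->
  exists c, forall y, sq_radius u c + mdist c y ^+ 2 <= sq_radius u y.
Proof.
move=> Xc XC ub.
have [||||c [_ cmin]] := strongly_midconvex_argmin setT (sq_radius u) 0 Xc.
- by case: ub => c _; exists c.
- by move=> y _; rewrite sqr_ge0.
(* Sublevel sets are closed because the radius is 1-Lipschitz in the point. *)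
- move=> v l a vl va; split=> //.
  have a0 : 0 <= a.
    by case: va => N _ /(_ N (leqnn N))[_]; apply: le_trans; rewrite sqr_ge0.
  suff : fine (asymptotic_radius u l) <= Num.sqrt a.
    move=> la; rewrite /sq_radius -[leRHS]sqr_sqrtr// lerXn2r//.
      by rewrite nnegrE fine_ge0// asymptotic_radius_ge0.
    by rewrite nnegrE sqrtr_ge0.
  apply/ler_addgt0Pr => e e0.
  rewrite -lee_fin fineK ?bounded_asymptotic_radius//.
  apply: asymptotic_radius_le.
  have e2 : 0 < e / 2 by rewrite divr_gt0.
  have [k [vk [_ rk]]] : exists k, mdist l (v k) < e / 2 /\
      (setT (v k) /\ sq_radius u (v k) <= a).
    have /metricType_numDomainType.cvgrPdist_lt/(_ _ e2) lk := vl.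
    by near \oo => k; exists k; split; near: k.
  have : (asymptotic_radius u (v k) < (Num.sqrt a + e / 2)%:E)%E.
    rewrite -[ltLHS]fineK ?bounded_asymptotic_radius// lte_fin ltr_pwDr//.
    rewrite -[leLHS]ger0_norm ?fine_ge0 ?asymptotic_radius_ge0// -sqrtr_sqr.
    by rewrite ler_sqrt.
  move=> /asymptotic_radius_near; apply: filterS => n un.
  rewrite (le_trans (metric_triangle _ (v k) _))//; lra.
- move=> y z _ _; have [m mP] := CAT0_midpoint y z XC.
  exists m; split => //; have [ym zm] := mP.
  apply/ler_addgt0Pr => e e0; apply: sq_radius_le => //.
  have := sq_radius_near u z e ub e0; have := sq_radius_near u y e ub e0.
  apply: filterS2 => n yn zn.
  have := XC.2 y z (u n) m ym zm.
  rewrite !(metric_sym (u n)); lra.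
by exists c => y; exact: cmin.
Unshelve. all: by end_near. Qed.

Lemma increasing_seq_ge (phi : nat -> nat) (n : nat) :
  increasing_seq phi -> (n <= phi n)%N.
Proof.
move=> phi_incr; elim: n => // n IH.
rewrite (leq_ltn_trans IH)// ltnNge.
by rewrite -[X in ~~ X]/(phi n.+1 <= phi n)%O phi_incr -ltnNge.
Qed.

Lemma bounded_subsequence {R : realType} {X : metricType R} (u : nat -> X)
    (phi : nat -> nat) : bounded_sequence u -> bounded_sequence (u \o phi).
Proof. by move=> [c [M uM]]; exists c, M => n; exact: uM. Qed.

(** A nonincreasing sequence of distances converges, and its limit is shared by all subsequences: a
    bound on one term bounds all later ones. *)
Lemma sq_radius_subsequence {R : realType} {X : metricType R} (u : nat -> X)
    (y : X) (phi : nat -> nat) : bounded_sequence u ->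
  (forall n k, (n <= k)%N -> mdist y (u k) ^+ 2 <= mdist y (u n) ^+ 2) ->
  increasing_seq phi -> sq_radius (u \o phi) y = sq_radius u y.
Proof.
move=> ub udec phi_incr; have upb := bounded_subsequence u phi ub.
apply/eqP; rewrite eq_le; apply/andP; split; apply/ler_addgt0Pr => e e0.
  have [n _ /(_ n (leqnn n)) un] := sq_radius_near u y e ub e0.
  apply: le_trans un; apply: sq_radius_le => //; exists n => // k /= nk.
  by apply: udec; rewrite (leq_trans nk)// increasing_seq_ge.
have [n _ /(_ n (leqnn n)) un] := sq_radius_near (u \o phi) y e upb e0.
by apply: le_trans un; apply: sq_radius_le => //; exists (phi n) => // k /= /udec.
Qed.

(** * Growth inequality and fixed points of the resolvent *)

Lemma convex_midpoint {R : realType} {X : metricType R} (F : X -> \bar R)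
    (y z : X) : geodesic_space X -> geodesically_convex F ->
    (forall x, (-oo < F x)%E) -> (F y < +oo)%E -> (F z < +oo)%E ->
  exists m, [/\ midpoint y z m, (F m < +oo)%E &
    fine (F m) <= 2^-1 * fine (F y) + 2^-1 * fine (F z)].
Proof.
move=> geo cvx FNy Fy Fz.
have fin x : (F x < +oo)%E -> F x = (fine (F x))%:E.
  by move=> Fx; rewrite fineK// fin_numElt FNy Fx.
have [<-|/geo[g [a [b [gab ga gb]]]]] := pselect (y = z).
  by exists y; split => //; [rewrite /midpoint !mdistxx mulr0 | lra].
have ab := gab.1.
pose m := g ((1 - 2^-1) * a + 2^-1 * b).
have Fm : (F m <= (2^-1 * fine (F y) + 2^-1 * fine (F z))%:E)%E.
  have := cvx g a b gab a b 2^-1; rewrite ga gb (fin _ Fy) (fin _ Fz) /=.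
  rewrite -!EFinM -EFinD => /(_ _ _ _)/le_trans; apply.
  - by rewrite in_itv/= lexx ab.
  - by rewrite in_itv/= lexx ab.
  - by rewrite in_itv/=; apply/andP; split; lra.
  - by rewrite lee_fin; lra.
have Fmy : (F m < +oo)%E by rewrite (le_lt_trans Fm) ?ltry.
exists m; split => //; last by rewrite -lee_fin -fin.
by rewrite -ga -gb; exact: geodesic_midpoint gab.
Qed.

(** Convexity of [F] and the CAT(0) inequality add up to strong midconvexity of the objective, which
    the minimum of [F] bounds below. *)
Lemma resolvent_argmin {R : realType} {X : metricType R} (F : X -> \bar R)
    (mu : R) (x : X) : complete_space X -> CAT0_space X ->
    (forall x, (-oo < F x)%E) -> proper_function F -> geodesically_convex F ->
    lower_semicontinuous F -> (exists p, minimizer F p) -> 0 < mu ->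
  let J := resolvent F mu x in (F J < +oo)%E /\
  forall y, (F y < +oo)%E ->
    mu * fine (F J) + mdist x J ^+ 2 + mdist J y ^+ 2 <=
    mu * fine (F y) + mdist x y ^+ 2.
Proof.
move=> Xc XC FNy [q Fq] cvx lsc [p pmin] mu0.
have fin y : (F y < +oo)%E -> F y = (fine (F y))%:E.
  by move=> Fy; rewrite fineK// fin_numElt FNy Fy.
have Fp : (F p < +oo)%E := le_lt_trans (pmin q) Fq.
pose D := [set y | (F y < +oo)%E].
pose g y := mu * fine (F y) + mdist x y ^+ 2.
have objE y : D y -> resolvent_objective F mu x y = (g y)%:E.
  by move=> Dy; rewrite /resolvent_objective (fin _ Dy).
have objNE y : ~ D y -> resolvent_objective F mu x y = +oo%E.
  move=> /negP; rewrite -leNgt leye_eq => /eqP Fy.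
  by rewrite /resolvent_objective Fy gt0_muley ?lte_fin// addye.
have [||||c [Dc cmin]] := strongly_midconvex_argmin D g (mu * fine (F p)) Xc.
- by exists p.
- move=> y Dy; rewrite -[leLHS]addr0 lerD ?sqr_ge0// ler_pM2l//.
  by rewrite -lee_fin -!fin// pmin.
- move=> u l a ul ua; have /metricType_numDomainType.cvgrPdist_lt luP := ul.
  suff Fl : (F l <= (mu^-1 * (a - mdist x l ^+ 2))%:E)%E.
    have Dl : D l by rewrite /D/= (le_lt_trans Fl) ?ltry.
    split => //; move: Fl; rewrite (fin _ Dl) lee_fin ler_pdivlMl// /g; lra.
  rewrite leNgt; apply/negP => Fl.
  (* If [F l] were too large, a level [b] strictly below it would, by semicontinuity, still be
     exceeded near [l], where [mu * b] plus the squared distance to [x] exceeds [a]. *)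
  have [b ab bF] : exists2 b, mu^-1 * (a - mdist x l ^+ 2) < b & (b%:E < F l)%E.
    have [Fly|] := ltP (F l) +oo%E; last first.
      rewrite leye_eq => /eqP ->; exists (mu^-1 * (a - mdist x l ^+ 2) + 1).
        by rewrite ltrDl.
      by rewrite ltry.
    move: Fl; rewrite (fin _ Fly) lte_fin => Fl.
    exists ((mu^-1 * (a - mdist x l ^+ 2) + fine (F l)) / 2); first by lra.
    by rewrite lte_fin; lra.
  have [V Vl VF] := lsc _ _ bF.
  rewrite ltr_pdivrMl// in ab.
  have [e e0 ebP] : exists2 e : R, 0 < e &
      forall y, mdist l y < e -> a - mdist x y ^+ 2 < mu * b.
    set s := mdist x l; set k := mu * b - (a - s ^+ 2).
    have s0 : 0 <= s := mdist_ge0 _ _.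
    have k0 : 0 < k by rewrite /k /s; lra.
    have s20 : 0 < 2 * s + 1 by lra.
    (* For [mdist x y < s], the difference of squares factors into at most [mdist l y] times
       [2 * s]; adding 1 keeps the divisor positive when [s] is 0. *)
    exists (k / (2 * s + 1)); first by rewrite divr_gt0.
    move=> y; rewrite ltr_pdivlMr// => ly.
    have := metric_triangle x y l; rewrite (metric_sym y l) -/s => sxy.
    have xy0 := mdist_ge0 x y; have ly0 := mdist_ge0 l y.
    suff : s ^+ 2 - mdist x y ^+ 2 < k by rewrite /k; lra.
    apply: le_lt_trans ly; have [xys|xys] := leP s (mdist x y).
      have : s ^+ 2 <= mdist x y ^+ 2 by rewrite lerXn2r// nnegrE.
      by have := mulr_ge0 ly0 (ltW s20); lra.
    by rewrite subr_sqr ler_pM ?subr_ge0 ?(ltW xys) ?addr_ge0//; lra.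
  have [n [Vn en [Dn gn]]] : exists n, [/\ V (u n), mdist l (u n) < e &
      D (u n) /\ g (u n) <= a].
    have uV := ul _ Vl; have ue := luP _ e0.
    by near \oo => n; exists n; split; near: n.
  have := VF _ Vn; rewrite (fin _ Dn) lte_fin -(ltr_pM2l mu0).
  by have := ebP _ en; move: gn; rewrite /g; lra.
- move=> y z Dy Dz.
  have [m [mP Dm Fm]] := convex_midpoint F y z XC.1 cvx FNy Dy Dz.
  rewrite -(ler_pM2l mu0) in Fm.
  by exists m; split => //; have := XC.2 y z x m mP.1 mP.2; rewrite /g; lra.
have cinf : resolvent_objective F mu x c =
    ereal_inf (range (resolvent_objective F mu x)).
  apply/eqP; rewrite eq_le; apply/andP; split; last first.
    by apply: ereal_inf_lbound; exists c.
  apply/ereal_infP => _ [y _ <-]; have [Dy|nDy] := pselect (D y).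
    by rewrite !objE// lee_fin (le_trans _ (cmin _ Dy))// lerDl sqr_ge0.
  by rewrite (objNE y)// leey.
have JE : resolvent_objective F mu x (resolvent F mu x) = (g c)%:E.
  rewrite -objE// cinf /resolvent.
  by have := xgetI x (cinf : [set p | resolvent_objective F mu x p = _] c).
have [DJ|nDJ] := pselect (D (resolvent F mu x)); last by rewrite objNE in JE.
move: JE; rewrite objE// => -[gJ].
(* The growth inequality makes the argmin unique, so the point chosen by [xget] is [c]. *)
have cJ : c = resolvent F mu x.
  apply: mdist_positivity; apply/eqP; rewrite -sqrf_eq0 eq_le sqr_ge0 andbT.
  by have := cmin _ DJ; rewrite gJ; lra.
by rewrite -cJ; split => // y Dy; exact: cmin.
Unshelve. all: by end_near. Qed.

(** At a fixed point the growth term cancels the squared distance in the objective, leaving a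
    comparison of values of [F]. *)
Lemma resolvent_fixpoint_minimizer {R : realType} {X : metricType R}
    (F : X -> \bar R) (mu : R) (c : X) :
    (forall x, (-oo < F x)%E) -> 0 < mu -> (F c < +oo)%E ->
    (forall y, (F y < +oo)%E ->
      mu * fine (F c) + mdist c c ^+ 2 + mdist c y ^+ 2 <=
      mu * fine (F y) + mdist c y ^+ 2) ->
  minimizer F c.
Proof.
move=> FNy mu0 Fc cmin y; have [Fy|] := ltP (F y) +oo%E; last first.
  by rewrite leye_eq => /eqP ->; rewrite leey.
rewrite -[F c]fineK ?fin_numElt ?FNy// -[F y]fineK ?fin_numElt ?FNy// lee_fin.
by have := cmin _ Fy; rewrite mdistxx expr0n addr0 lerD2r ler_pM2l.
Qed.

(** * Delta-convergence of the Picard iterates *)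

Theorem corollary6p6 (R : realType) (X : metricType R) (F : X -> \bar R)
    (X_complete : complete_space X) (X_CAT0 : CAT0_space X)
    (F_gtNy : forall x : X, (-oo < F x)%E)
    (F_proper : proper_function F) (F_convex : geodesically_convex F)
    (F_lsc : lower_semicontinuous F)
    (F_minimizer : exists p : X, minimizer F p)
    (mu : R) (mu_gt0 : 0 < mu) (x : X) :
  exists p : X,
    minimizer F p /\ Delta_cvg (fun n => iter n (resolvent F mu) x) p.
Proof.
set J := resolvent F mu; set u := fun n => iter n J x.
have JP y : (F (J y) < +oo)%E /\ forall z, (F z < +oo)%E ->
    mu * fine (F (J y)) + mdist y (J y) ^+ 2 + mdist (J y) z ^+ 2 <=
    mu * fine (F z) + mdist y z ^+ 2.
  exact: resolvent_argmin.
have minF q : minimizer F q -> (F q < +oo)%E.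
  by move=> qmin; exact: le_lt_trans (qmin (J x)) (JP x).1.
have minJ q y : minimizer F q -> mu * fine (F q) <= mu * fine (F (J y)).
  by move=> qmin; rewrite ler_pM2l// fine_le ?fin_numElt ?F_gtNy ?(JP y).1 ?minF.
have decr q : minimizer F q -> forall n k, (n <= k)%N ->
    mdist q (u k) ^+ 2 <= mdist q (u n) ^+ 2.
  move=> qmin n k /subnK <-; elim: (k - n)%N => // {}k; apply: le_trans.
  rewrite addSn /= -/(u (k + n)%N) !(metric_sym q).
  have := (JP (u (k + n)%N)).2 q (minF q qmin).
  have := minJ q (u (k + n)%N) qmin.
  by have := sqr_ge0 (mdist (u (k + n)%N) (J (u (k + n)%N))); lra.
have [q qmin] := F_minimizer.
have ub : bounded_sequence u.
  exists q, (mdist q (u 0%N)) => n.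
  by rewrite -(ler_pXn2r (_ : 0 < 2)%N) ?nnegrE ?mdist_ge0// decr.
have Fu e : 0 < e -> \forall n \near \oo,
    (F (u n) < +oo)%E /\ mu * fine (F (u n)) <= mu * fine (F q) + e.
  move=> e0; have [N _ uN] := sq_radius_near u q e ub e0.
  (* The gap at [u n.+1] is at most the drop of the squared distance to [q] from step [n], hence at
     most [e]. Index 0 is excluded since [F x] may be infinite. *)
  exists N.+1 => // -[//|n] /= Nn; rewrite -/(u n); split; first exact: (JP _).1.
  have := uN n Nn.
  have : sq_radius u q <= mdist q (u n.+1) ^+ 2.
    apply: sq_radius_le => //; exists n.+1 => // k nk.
    exact: (decr q qmin n.+1).
  have := (JP (u n)).2 q (minF q qmin).
  rewrite /= -/(u n) !(metric_sym q).
  by have := sqr_ge0 (mdist (u n) (J (u n))); lra.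
have center_min (phi : nat -> nat) c : increasing_seq phi ->
    (forall y,
      sq_radius (u \o phi) c + mdist c y ^+ 2 <= sq_radius (u \o phi) y) ->
    minimizer F c.
  move=> phi_incr cmin; have upb := bounded_subsequence u phi ub.
  (* The growth inequality for J c at the points of the subsequence, whose
     values of F tend to the minimum, bounds the radius at J c. *)
  have rJ : sq_radius (u \o phi) (J c) + mdist c (J c) ^+ 2 <=
      sq_radius (u \o phi) c.
    rewrite -lerBrDr; apply/ler_addgt0Pr => e e0; apply: sq_radius_le => //.
    have e2 : 0 < e / 2 by rewrite divr_gt0.
    have [N _ uN] := Fu _ e2.
    have [M _ cM] := sq_radius_near (u \o phi) c _ upb e2.
    exists (maxn N M) => // n /=; rewrite geq_max => /andP[Nn Mn].
    have [Fn fn] := uN (phi n) (leq_trans Nn (increasing_seq_ge phi n phi_incr)).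
    have := cM n Mn; have := (JP c).2 _ Fn; have := minJ q c qmin.
    by rewrite /=; lra.
  (* Adding [rJ] to [cmin] at [J c] cancels the radii and leaves twice the squared distance at most
     0. *)
  have cJ : c = J c.
    apply: mdist_positivity; apply/eqP; rewrite -sqrf_eq0 eq_le sqr_ge0 andbT.
    by have := cmin (J c); lra.
  have := JP c; rewrite -cJ => -[Fc cgrowth].
  exact: (resolvent_fixpoint_minimizer F mu).
have [p pmin] := sq_radius_argmin u X_complete X_CAT0 ub.
have p_min : minimizer F p by apply: (center_min id).
exists p; split=> //; split=> // phi phi_incr.
have upb := bounded_subsequence u phi ub.
have [c cmin] := sq_radius_argmin (u \o phi) X_complete X_CAT0 upb.
have c_min := center_min phi c phi_incr cmin.
have subE y : minimizer F y -> sq_radius (u \o phi) y = sq_radius u y.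
  by move=> ymin; apply: sq_radius_subsequence => //; exact: decr.
(* The growth inequalities of [p] for [u] and of [c] for the subsequence involve the same two radii,
   which cancel when added. *)
have cp : c = p.
  apply: mdist_positivity; apply/eqP; rewrite -sqrf_eq0 eq_le sqr_ge0 andbT.
  have := cmin p; have := pmin c; rewrite !subE// (metric_sym p).
  by have := sqr_ge0 (mdist c p); lra.
rewrite cp in cmin; split=> [|d /asymptotic_centerP dmin].
  apply/asymptotic_centerP => // y.
  by rewrite (le_trans _ (cmin y))// lerDl sqr_ge0.
(* Any other center [d] has radius at most that of [p], so the growth inequality at [d] forces
   distance 0. *)
apply/esym/mdist_positivity/eqP; rewrite -sqrf_eq0 eq_le sqr_ge0 andbT.
by have := cmin d; have := dmin upb p; lra.
Qed.
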